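(* Let $n\ge2$ and $\lambda\vdash n-1$. 1. For every $P\in\mathrm{SYT}(\lambda^\Box)$, $$\mathrm{cDes}(P)\cap[n-1]=\mathrm{Des}(P).$$ 2. The map $p:\mathrm{SYT}(\lambda^\Box)\to\mathrm{SYT}(\lambda^\Box)$ given by $$p(P)=\mathrm{jdt}\big(1+\mathrm{jdt}^{-1}(P)\big)$$ determines a $\mathbb{Z}_n$-action on $\mathrm{SYT}(\lambda^\Box)$ (i.e. $p$ is a bijection with $p^n=\mathrm{id}$, so that $1\in\mathbb{Z}_n$ acts by $p$), which rotates the cyclic descent sets of the tableaux: $\mathrm{cDes}(p(P))=1+\mathrm{cDes}(P)$ for every $P\in\mathrm{SYT}(\lambda^\Box)$, with addition modulo $n$.
   Context: Tableaux are drawn in English notation (row indices increase from top to bottom). For $\lambda\vdash n-1$, $\lambda^\Box$ is the skew shape with $n$ cells obtained from the Young diagram of $\lambda$ by placing one disconnected box at its upper right corner: its cells are $(r,j)$ with $1\le j\le\lambda_r$ (row $r\ge1$), together with the cell $(0,\lambda_1+1)$. $\mathrm{SYT}(\lambda^\Box)$ is the set of standard Young tableaux of this shape (bijective fillings by $1,\dots,n$, increasing along rows from left to right and down columns). For a filling $P$ of $\lambda^\Box$, $\delta(P)$ is the entry in the upper right (disconnected) box. For an integer $k$ and a filling $R$, $k+R$ is the filling obtained by adding $k$ modulo $n$ to every entry, with entries taken in $[n]=\{1,\dots,n\}$, identified with $\mathbb{Z}_n$ (so $0$ is identified with $n$). For $D\subseteq[n]$, $k+D=\{k+d:d\in D\}\subseteq[n]$,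 with addition modulo $n$. Let $\mathcal{R}_\lambda=\{k+T:\ T\in\mathrm{SYT}(\lambda^\Box),\ \delta(T)=n,\ 0\le k<n\}$. For $R=k+T\in\mathcal{R}_\lambda$, $\mathrm{jdt}(R)$ is the standard tableau produced by the following procedure. Set $T_0=R$ and, until $T_0$ is standard (rows and columns increasing), repeat the following elementary step: let $i$ be the minimal entry in $T_0$ for which the entry immediately above it or immediately to the left of it is larger than $i$; switch $i$ with the larger of these two entries (if only one of the two cells exists, with the entry in that cell), and let $T_0$ be the resulting tableau. Then $\mathrm{jdt}(R)$ is the final $T_0$. The map $\mathrm{jdt}:\mathcal{R}_\lambda\to\mathrm{SYT}(\lambda^\Box)$ is a bijection (for each $k$ it restricts to a bijection from $\{k+T: T\in\mathrm{SYT}(\lambda^\Box),\delta(T)=n\}$ to $\{P\in\mathrm{SYT}(\lambda^\Box):\delta(P)=k\}$, with $0$ identified with $n$), and $\mathrm{jdt}^{-1}$ denotes its inverse. Note that $\mathcal{R}_\lambda$ is closed under $R\mapsto1+R$. For $P\in\mathrm{SYT}(\lambda^\Box)$, $\mathrm{Des}(P)=\{i\in[n-1]: i+1\text{ is in a (strictly) lower row than }i\text{ in }P\}$. For $R\in\mathcal{R}_\lambda$, $\mathrm{cDes}_{\mathrm{rot}}(R)=\{i\in[n]: i+1\text{ is in a (strictly) lower row than }i\text{ in }R\}$, where $i+1$ is taken modulo $n$ (so $n+1$ means $1$). The cyclic descent set of $P\in\mathrm{SYT}(\lambda^\Box)$ is $\mathrm{cDes}(P)=\mathrm{cDes}_{\mathrm{rot}}(\mathrm{jdt}^{-1}(P))\subseteq[n]$.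 *)

(* Defs.v *)
From mathcomp Require Import all_boot.

Set Implicit Arguments.
Unset Strict Implicit.
Unset Printing Implicit Defensive.

Definition is_part (m : nat) (la : seq nat) : bool :=
  [&& sorted geq la, 0 \notin la & sumn la == m].

(* Cells (row, column) of the skew shape la^Box; the disconnected box comes
   first, and the cells of the diagram of la have 1-based coordinates. *)
Definition shape_cells (la : seq nat) : seq (nat * nat) :=
  (0, (head 0 la).+1)
    :: [seq (r, j) | r <- iota 1 (size la), j <- iota 1 (nth 0 la r.-1)].

Definition cell (la : seq nat) := seq_sub (shape_cells la).

Definition row (la : seq nat) (c : cell la) : nat := (val c).1.
Definition col (la : seq nat) (c : cell la) : nat := (val c).2.

Definition box (la : seq nat) : cell la :=
  SeqSub (mem_head _ _ : (0, (head 0 la).+1) \in shape_cells la).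

(* The set [n] = {1, ..., n} is represented by 'I_n, the ordinal x standing for
   the integer x + 1. This encoding preserves the order and commutes with adding
   an integer modulo n (with n identified with 0); ordS is "+1 modulo n". *)
Definition filling (n : nat) (la : seq nat) := {ffun cell la -> 'I_n}.

Section Tableaux.
Variables (n : nat) (la : seq nat).
Implicit Types (T P R : filling n la) (c d : cell la) (i j : 'I_n).

Definition bijective_filling T : bool :=
  injectiveb T && [forall i, i \in codom T].

Definition rows_increasing T : bool :=
  [forall c, forall d, (row c == row d) && (col c < col d) ==> (T c < T d)].

Definition columns_increasing T : bool :=
  [forall c, forall d, (col c == col d) && (row c < row d) ==> (T c < T d)].

Definition standard T : bool :=
  [&& bijective_filling T, rows_increasing T & columns_increasing T].

Definition SYT : {set filling n la} := [set T | standard T].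

Definition delta T : 'I_n := T (box la).

Definition add_filling (k : nat) T : filling n la :=
  [ffun c => iter k (@ordS n) (T c)].

Definition add_set (k : nat) (D : {set 'I_n}) : {set 'I_n} :=
  [set iter k (@ordS n) i | i in D].

(* The set R_lambda; the entry n is the ordinal n.-1. *)
Definition rotations : {set filling n la} :=
  [set R | [exists T in SYT, (delta T == n.-1 :> nat) &&
             [exists k : 'I_n, R == add_filling k T]]].

(* d is the cell immediately above c, or immediately to the left of c. *)
Definition precedes d c : bool :=
  ((row d).+1 == row c) && (col d == col c) ||
  (row d == row c) && ((col d).+1 == col c).

Definition misplaced T c : bool := [exists d, precedes d c && (T c < T d)].

(* c holds the minimal misplaced entry, d the larger of the entries immediately
   above or to the left of c. *)
Definition to_switch T c d : bool :=
  [&& misplaced T c, [forall c', misplaced T c' ==> (T c <= T c')],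
      precedes d c & [forall d', precedes d' c ==> (T d' <= T d)]].

Definition jdt_step T : filling n la :=
  if [pick u : cell la * cell la | to_switch T u.1 u.2] is Some (c, d)
  then [ffun e => if e == c then T d else if e == d then T c else T e]
  else T.

(* orbit jdt_step R lists R, jdt_step R, jdt_step (jdt_step R), ... up to the
   first repetition, so that jdt R is the first standard iterate. *)
Definition jdt R : filling n la :=
  let s := orbit jdt_step R in nth R s (find standard s).

(* Inverse of the bijection jdt : rotations -> SYT; the default value P is
   irrelevant for P \in SYT. *)
Definition jdt_inv P : filling n la :=
  odflt P [pick R in rotations | jdt R == P].

Definition in_lower_row T i j : bool :=
  [exists c, exists d, [&& T c == i, T d == j & row c < row d]].

(* The subset [n-1] of [n]. *)
Definition below_n : {set 'I_n} := [set i : 'I_n | i.+1 < n].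

Definition Des P : {set 'I_n} :=
  [set i in below_n | in_lower_row P i (ordS i)].

Definition cDes_rot R : {set 'I_n} := [set i | in_lower_row R i (ordS i)].

Definition cDes P : {set 'I_n} := cDes_rot (jdt_inv P).

Definition promotion P : filling n la := jdt (add_filling 1 (jdt_inv P)).

End Tableaux.

(* Main.v *)
(* A standard filling is read as the word of its cells in the order of their
   entries, a linear extension of the cell poset. For R = k + T this word is
   U ++ S, where the cells of U hold the entries greater than k and those of S
   the entries at most k, the box being the last cell of S. Every switch made
   by jdt exchanges a small entry with a large one, so jdt carries U ++ S
   to S' ++ U', where (S', U') is obtained by passing every cell of S through
   every cell of U by Bender-Knuth moves (tableau switching). This is an
   involution, which makes jdt a bijection. Its elementary moves fill a
   rectangle, so it can be computed by moving one small entry through all the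
   large ones or one large entry through all the small ones; in either way the
   descents among the entries being passed through are preserved, by a case
   analysis on three consecutive cells. The only other descent, between k and
   k + 1, is always present because k is in the box. *)
Require Import Defs.
From mathcomp Require Import all_boot perm zify.

Set Implicit Arguments.
Unset Strict Implicit.
Unset Printing Implicit Defensive.

(** * Tableau switching on words over a set with an adjacency relation *)

Section Switching.
Variables (X : Type) (adj : X -> X -> bool).

(* Consecutive cells [u], [s] of a linear extension are exchanged unless they
   are adjacent, in which case they keep their places and it is the entries
   that are switched. *)
Definition pass (u s : X) : X * X := if adj u s then (u, s) else (s, u).

(** Rewrites the word [U ++ [:: c]] as [c' :: U'], the cell next to [c] being passed first; [push]
    is the mirror image, rewriting [u :: S] as [rcons S' u']. *)
Fixpoint slide (U : seq X) (c : X) : X * seq X :=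
  if U is u :: U1 then
    let: (c1, U2) := slide U1 c in
    let: (c2, u') := pass u c1 in (c2, u' :: U2)
  else (c, [::]).

Fixpoint push (u : X) (S : seq X) : seq X * X :=
  if S is s :: S1 then
    let: (s', u1) := pass u s in
    let: (S2, u2) := push u1 S1 in (s' :: S2, u2)
  else ([::], u).

Fixpoint switch (U S : seq X) : seq X * seq X :=
  if S is s :: S1 then
    let: (s', U1) := slide U s in
    let: (S2, U2) := switch U1 S1 in (s' :: S2, U2)
  else ([::], U).

Lemma size_slide U c : size (slide U c).2 = size U.
Proof.
elim: U => //= u U; case: (slide U c) => c1 U2 /= <-.
by case: (pass u c1).
Qed.

Lemma size_switch U S :
  size (switch U S).1 = size S /\ size (switch U S).2 = size U.
Proof.
elim: S U => //= s S IH U; have := size_slide U s.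
case: (slide U s) => s' U1 /= eU1; have := IH U1.
by case: (switch U1 S) => S2 U2 /= [-> ->]; rewrite eU1.
Qed.

Lemma switch0 S : switch [::] S = (S, [::]).
Proof. by elim: S => //= s S ->. Qed.

(* The rectangle of elementary passes can be filled in by rows or by columns. *)
Lemma switch_cons u U S :
  switch (u :: U) S =
    let: (S1, U1) := switch U S in let: (S2, u') := push u S1 in (S2, u' :: U1).
Proof.
elim: S u U => //= s S IH u U.
case: (slide U s) => c1 U1; case ep: (pass u c1) => [c2 u1].
rewrite IH; case: (switch U1 S) => S1 U2 /=; rewrite ep.
by case: (push u1 S1).
Qed.

Hypothesis adjC : symmetric adj.

Lemma pass_inv u s s' u' : pass u s = (s', u') -> pass s' u' = (u, s).
Proof.
rewrite /pass; case a: (adj u s) => -[<- <-]; first by rewrite a.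
by rewrite adjC a.
Qed.

Lemma slide_inv U c c' U' : slide U c = (c', U') -> push c' U' = (U, c).
Proof.
elim: U c' U' => [|u U IH] c' U' /=; first by case=> <- <-.
case es: (slide U c) => [c1 U1]; case ep: (pass u c1) => [c2 u1] [<- <-] /=.
by rewrite (pass_inv ep) (IH _ _ es).
Qed.

(** The slides are undone last to first: [switch_cons] isolates the push that reverts the first
    slide, after the induction hypothesis has reverted the others. *)
Lemma switch_inv U S S' U' : switch U S = (S', U') -> switch S' U' = (U, S).
Proof.
elim: S U S' U' => [|s S IH] U S' U' /=; first by case=> <- <-; exact: switch0.
case es: (slide U s) => [s' U1]; case ew: (switch U1 S) => [S2 U2] [<- <-].
by rewrite switch_cons (IH _ _ _ ew) (slide_inv es).
Qed.

Variable b : X.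
Hypothesis adjb : forall x, adj b x = false.

Lemma slide_isolated U : slide U b = (b, U).
Proof. by elim: U => //= u U ->; rewrite /pass adjC adjb. Qed.

(** An isolated cell slides freely through everything. For the disconnected box this locates the cut
    between [S'] and [U']. *)
Lemma switch_rcons_isolated U S S' U' :
  switch U (rcons S b) = (S', U') -> exists S0, S' = rcons S0 b.
Proof.
elim: S U S' U' => [|s S IH] U S' U' /=.
  by rewrite slide_isolated => -[<- _]; exists [::].
case: (slide U s) => s' U1; case ew: (switch U1 (rcons S b)) => [S2 U2] [<- _].
by have [S0 ->] := IH _ _ _ ew; exists (s' :: S0).
Qed.

(** The mirror case, needed to build preimages: cells sliding leftwards jump over [b], which stays
    at the end. *)
Lemma switch_isolated_rcons U S S' U' :
  switch (rcons U b) S = (S', U') -> exists U0, U' = rcons U0 b.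
Proof.
have slideE V c : exists c' V0, slide (rcons V b) c = (c', rcons V0 b).
  elim: V => [|v V [c' [V0 /= ->]]]; first by exists c, [::]; rewrite /= /pass adjb.
  by case ep: (pass v c') => [c2 v']; exists c2, (v' :: V0).
elim: S U S' U' => [|s S IH] U S' U' /=; first by case=> _ <-; exists U.
have [s' [V0 ->]] := slideE U s.
case ew: (switch (rcons V0 b) S) => [S2 U2] [_ <-].
exact: IH ew.
Qed.

End Switching.

(** * Linear extensions of the cell poset *)

Section Words.
Variable la : seq nat.
Implicit Types (c d x y u s : cell la) (W A B U S V : seq (cell la)).

Definition adjacent c d := precedes c d || precedes d c.

Lemma adjacentC : symmetric adjacent.
Proof. by move=> c d; rewrite /adjacent orbC. Qed.

Lemma mem_shape_cells r j :
  ((r, j) \in shape_cells la) =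
  (r == 0) && (j == (head 0 la).+1) || [&& 0 < r, 0 < j & j <= nth 0 la r.-1].
Proof.
rewrite inE xpair_eqE; congr orb.
apply/allpairsPdep/idP => [[r' [j' []]]|/and3P[r0 j0 jr]].
  rewrite !mem_iota => hr hj [-> ->]; lia.
exists r, j; rewrite !mem_iota; split=> //; last lia.
have : r.-1 < size la; last by lia.
by rewrite ltnNge; apply/negP => h; move: jr; rewrite nth_default //; lia.
Qed.

Lemma cell_eq c d : row c = row d -> col c = col d -> c = d.
Proof.
rewrite /row /col => hr hc; apply: val_inj.
by case: (val c) (val d) hr hc => [? ?] [? ?] /= -> ->.
Qed.

Lemma cell_box_or c :
  c = box la \/ [/\ 0 < row c, 0 < col c & col c <= nth 0 la (row c).-1].
Proof.
have := valP c; rewrite [val c]surjective_pairing mem_shape_cells.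
case/orP=> [/andP[/eqP h1 /eqP h2]|/and3P[? ? ?]]; [left|by right].
exact: cell_eq.
Qed.

Lemma exists_cell r j :
  0 < r -> 0 < j -> j <= nth 0 la r.-1 -> exists c, row c = r /\ col c = j.
Proof.
move=> r0 j0 jr; have h : (r, j) \in shape_cells la.
  by rewrite mem_shape_cells r0 j0 jr orbT.
by exists (SeqSub h).
Qed.

Lemma row_box : row (box la) = 0. Proof. by []. Qed.
Lemma col_box : col (box la) = (head 0 la).+1. Proof. by []. Qed.

Lemma precedesP d c : precedes d c ->
  (row c = (row d).+1 /\ col c = col d) \/ (row c = row d /\ col c = (col d).+1).
Proof. by case/orP=> /andP[/eqP h1 /eqP h2]; [left|right]; split. Qed.

(** The box lies one column beyond the first row, so no cell is right below it, and row 0 has no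
    other cell. *)
Lemma adjacent_box c : adjacent (box la) c = false.
Proof.
apply/negP; rewrite /adjacent /precedes row_box col_box -nth0.
case: (cell_box_or c) => [->|[]]; rewrite ?row_box ?col_box -?nth0; first by lia.
move=> h1 h2; case: (row c) h1 => // -[|r] _ /=; lia.
Qed.

(** Only cover relations are imposed; [linear_row] and [linear_col] derive the order along whole
    rows and columns. *)
Definition linear_extension W : bool :=
  [&& uniq W, [forall c, c \in W] &
    [forall d, forall c, precedes d c ==> (index d W < index c W)]].

Lemma linear_extensionP W :
  reflect [/\ uniq W, forall c, c \in W &
             forall d c, precedes d c -> index d W < index c W]
          (linear_extension W).
Proof.
apply: (iffP and3P) => [[h1 /forallP h2 /forallP h3]|[h1 h2 h3]].
  by split=> // d c; move/forallP: (h3 d) => /(_ c) /implyP.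
split=> //; first exact/forallP.
by apply/forallP => d; apply/forallP => c; apply/implyP; exact: h3.
Qed.

Lemma linear_row W c d : linear_extension W ->
  row c = row d -> col c < col d -> index c W < index d W.
Proof.
case/linear_extensionP=> _ _ lW rcd.
move: {2}(col d) (erefl (col d)) => j; elim: j d rcd => [|j IH] d rcd jd cd.
  by rewrite jd in cd.
have [ceq|cne] := eqVneq (col c) j.
  by apply: lW; rewrite /precedes rcd eqxx jd ceq eqxx orbT.
case: (cell_box_or c) => [cb|[c1 c2 c3]].
  case: (cell_box_or d) => [db|[d1 d2 d3]]; last by rewrite -rcd cb in d1.
  by rewrite cb db ltnn in cd.
case: (cell_box_or d) => [db|[d1 d2 d3]]; first by rewrite rcd db in c1.
have [] := @exists_cell (row d) j; [lia|lia|lia|] => m [rm cm].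
have im : index m W < index d W.
  by apply: lW; rewrite /precedes rm cm jd !eqxx orbT.
by apply: ltn_trans im; apply: IH => //; [rewrite rm | lia].
Qed.

Lemma index_cat_cons A B c : uniq (A ++ c :: B) -> index c (A ++ c :: B) = size A.
Proof.
rewrite cat_uniq /= => /and3P[_ /norP[cA _] _].
by rewrite index_cat (negPf cA) /= eqxx addn0.
Qed.

(** If the two cells were further apart in their row, the left neighbour of [b] would need a place
    between two consecutive letters. *)
Lemma linear_adjacent A a b B : linear_extension (A ++ a :: b :: B) ->
  row a = row b -> precedes a b.
Proof.
move=> l rab; have /linear_extensionP[uW mW lW] := l.
have ia := index_cat_cons uW.
have ib : index b (A ++ a :: b :: B) = (size A).+1.
  by move: uW; rewrite -cat_rcons => /index_cat_cons ->; rewrite size_rcons.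
rewrite /precedes rab eqxx /=; apply/orP; right.
case: (ltngtP (col a) (col b)) => [cab|cba|ceq].
- rewrite eqn_leq cab leqNgt; apply/negP => cab2.
  case: (cell_box_or b) => [bb|[d1 d2 d3]].
    case: (cell_box_or a) => [aa|[]]; last by rewrite rab bb.
    by rewrite aa bb ltnn in cab.
  have [] := @exists_cell (row b) (col b).-1; [lia|lia|lia|] => m [rm cm].
  have im : index m (A ++ a :: b :: B) < index b (A ++ a :: b :: B).
    by apply: lW; rewrite /precedes rm cm; lia.
  have : index a (A ++ a :: b :: B) < index m (A ++ a :: b :: B).
    by apply: linear_row => //; [rewrite rm | lia].
  by rewrite ia; rewrite ib in im; lia.
- by have := linear_row l (esym rab) cba; rewrite ia ib; lia.
- by have e := cell_eq rab ceq; move: ia ib; rewrite e; lia.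
Qed.

Lemma linear_between A a b c m B : linear_extension (A ++ a :: b :: c :: B) ->
  precedes a m -> precedes m c -> m = b.
Proof.
case/linear_extensionP=> uW mW lW /lW + /lW.
rewrite (index_cat_cons uW).
have -> : index c (A ++ a :: b :: c :: B) = (size A).+2.
  by move: uW; rewrite -2!cat_rcons => /index_cat_cons ->; rewrite !size_rcons.
move=> h1 h2; have e : index m (A ++ a :: b :: c :: B) = (size A).+1 by lia.
have := nth_index a (mW m); rewrite e nth_cat.
by rewrite ltnNge leqnSn /= subSnn.
Qed.

Lemma linear_precedes A a b B x : linear_extension (A ++ a :: b :: B) ->
  x \in b :: B -> adjacent a x -> precedes a x.
Proof.
case/linear_extensionP=> uW mW lW xB /orP[//|/lW].
rewrite (index_cat_cons uW) index_cat.
move: uW; rewrite cat_uniq => /and3P[_ /hasPn /= /(_ x)].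
by rewrite in_cons xB orbT => /(_ isT) /negPf -> _; rewrite ltnNge leq_addr.
Qed.

(** An exchange reverses only the relative order of [u] and [s], and it happens only when neither
    covers the other. *)
Lemma linear_pass A u s s' u' B : linear_extension (A ++ u :: s :: B) ->
  pass adjacent u s = (s', u') -> linear_extension (A ++ s' :: u' :: B).
Proof.
move=> l; rewrite /pass; case: ifP => [_ [<- <-] //|adj [<- <-]].
have /linear_extensionP[uW mW lW] := l.
have pW : perm_eq (A ++ u :: s :: B) (A ++ s :: u :: B).
  by rewrite perm_cat2l -(cat1s u) -(cat1s s) -(cat1s u B) -(cat1s s (_ ++ _)) perm_catCA.
apply/linear_extensionP; split=> [|c|d c pdc]; first by rewrite -(perm_uniq pW).
  by rewrite -(perm_mem pW).
have := lW _ _ pdc; rewrite !index_cat /=.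
have us : u != s.
  by move: uW; rewrite cat_uniq => /and3P[_ _ /= /andP[+ _]]; rewrite inE; case: eqVneq.
have := index_mem d A; have := index_mem c A.
case: (d \in A); case: (c \in A) => // hc hd.
- by move=> _; apply: leq_trans (leq_addr _ _).
- by rewrite ltnNge (leq_trans (ltnW hc)) ?leq_addr.
rewrite !ltn_add2l {hc hd}.
have [ud|] := eqVneq u d; have [uc|] := eqVneq u c;
  have [sd|] := eqVneq s d; have [sc|] := eqVneq s c => //=; subst => //.
all: rewrite ?eqxx // in us *; try lia.
by move: adj; rewrite /adjacent pdc.
Qed.

Lemma linear_slide A U c c' U' B : linear_extension (A ++ U ++ c :: B) ->
  slide adjacent U c = (c', U') -> linear_extension (A ++ c' :: U' ++ B).
Proof.
elim: U A c' U' => [|u U IH] A c' U' /=; first by move=> l [<- <-].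
move=> l; case es: (slide _ U c) => [c1 U1].
case ep: (pass _ u c1) => [c2 u1] [<- <-] /=.
apply: linear_pass ep; rewrite -cat_rcons.
by apply: IH es; rewrite cat_rcons.
Qed.

Lemma linear_switch A U S S' U' : linear_extension (A ++ U ++ S) ->
  switch adjacent U S = (S', U') -> linear_extension (A ++ S' ++ U').
Proof.
elim: S A U S' U' => [|s S IH] A U S' U' /=.
  by move=> l [<- <-]; rewrite cats0 in l.
move=> l; case es: (slide _ U s) => [s1 U1].
case ew: (switch _ U1 S) => [S1 U2] [<- <-] /=.
rewrite -cat_rcons; apply: IH ew; rewrite cat_rcons.
exact: linear_slide l es.
Qed.

(** * Partition shapes and the invariance of descents *)

Hypothesis la_sorted : sorted geq la.

Lemma nth_la_le r r' : r <= r' -> nth 0 la r' <= nth 0 la r.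
Proof.
move=> rr'; case: (ltnP r' (size la)) => h; last by rewrite (nth_default _ h).
apply: (sorted_leq_nth _ _ 0 la_sorted) => //.
- by move=> y x z /= h1 h2; exact: leq_trans h2 h1.
- by move=> x /=.
- by rewrite inE; exact: leq_ltn_trans rr' h.
Qed.

Lemma linear_col W c d : linear_extension W ->
  col c = col d -> row c < row d -> index c W < index d W.
Proof.
case/linear_extensionP=> _ _ lW rcd.
move: {2}(row d) (erefl (row d)) => j; elim: j d rcd => [|j IH] d rcd jd cd.
  by rewrite jd in cd.
have [ceq|cne] := eqVneq (row c) j.
  by apply: lW; rewrite /precedes rcd eqxx jd ceq eqxx.
case: (cell_box_or d) => [db|[d1 d2 d3]]; first by rewrite db in cd.
have := @nth_la_le j.-1 (row d).-1.
have := @nth_la_le 0 (row d).-1.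
(* No row is longer than the first, so the column of the box meets no other cell. *)
case: (cell_box_or c) => [cb|[c1 c2 c3]].
  by rewrite nth0; move: rcd; rewrite cb col_box; lia.
move=> _ hn; have [] := @exists_cell j (col d); [lia|lia|lia|] => m [rm cm].
have im : index m W < index d W.
  by apply: lW; rewrite /precedes rm cm jd !eqxx.
by apply: ltn_trans im; apply: IH => //; [rewrite cm | lia].
Qed.

(* [a], [b], [c] are added consecutively to an order ideal, so every cell of the
   poset strictly between two of them is the third; this excludes each
   configuration in which a move would change the descent. *)
Lemma pass2_descent A a b c B c1 b' c2 a' :
  linear_extension (A ++ a :: b :: c :: B) ->
  pass adjacent b c = (c1, b') -> pass adjacent a c1 = (c2, a') ->
  (row a < row b) = (row a' < row b').
Proof.
move=> l; have l' : linear_extension (rcons A a ++ b :: c :: B).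
  by rewrite cat_rcons.
have [_ mW lW] := linear_extensionP _ l.
rewrite /pass; case: ifP => bc [<- <-]; case: ifP => ac [_ <-] //.
- have pab : precedes a b by apply: linear_precedes l _ ac; rewrite inE eqxx.
  have pbc : precedes b c by apply: linear_precedes l' _ bc; rewrite inE eqxx.
  case: (precedesP pab) (precedesP pbc) => [[r1 c1']|[r1 c1']] [[r2 c2']|[r2 c2']];
    rewrite ?r2 ?r1; try lia.
  (* [a] above [b], [b] left of [c]: the cell right of [a] and above [c] also lies between them, so
     it would have to be [b]. *)
  + case: (cell_box_or c) => [cb|[d1 d2 d3]]; first by rewrite cb row_box in r2; lia.
    have := @nth_la_le (row a).-1 (row c).-1.
    case: (cell_box_or a) => [ab|[e1 e2 e3]] h4.
      by have := adjacent_box b; rewrite -ab /adjacent pab.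
    have [] := @exists_cell (row a) (col c); [lia|lia|lia|] => m [rm cm].
    have mb : m = b by apply: linear_between l _ _; rewrite /precedes rm cm; lia.
    by rewrite mb in rm; lia.
  (* The transposed bend: the cell below [a] and left of [c] gives the contradiction. *)
  + case: (cell_box_or c) => [cb|[d1 d2 d3]]; first by rewrite cb row_box in r2; lia.
    case: (cell_box_or a) => [ab|[e1 e2 e3]].
      by have := adjacent_box b; rewrite -ab /adjacent pab.
    have [] := @exists_cell (row c) (col a); [lia|lia|lia|] => m [rm cm].
    have mb : m = b by apply: linear_between l _ _; rewrite /precedes rm cm; lia.
    by rewrite mb in rm; lia.
- have pbc : precedes b c by apply: linear_precedes l' _ bc; rewrite inE eqxx.
  case: (precedesP pbc) => [[r2 c2']|[r2 c2']]; rewrite r2 //.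
  (* The two sides differ only when [a] and [b] share a row; being consecutive letters, they would
     then be adjacent. *)
  have [rab|] := eqVneq (row a) (row b); last by lia.
  by move: ac; rewrite /adjacent (linear_adjacent l rab).
- have pac : precedes a c.
    by apply: linear_precedes l _ ac; rewrite !inE eqxx orbT.
  case: (precedesP pac) => [[r2 c2']|[r2 c2']]; rewrite r2 //.
  have [rbc|] := eqVneq (row b) (row c); last by lia.
  by move: bc; rewrite /adjacent (linear_adjacent l' rbc).
Qed.

Fixpoint descents W : seq bool :=
  if W is x :: W' then
    if W' is y :: _ then (row x < row y) :: descents W' else [::]
  else [::].

Lemma nth_descents x0 W i : i.+1 < size W ->
  nth false (descents W) i = (row (nth x0 W i) < row (nth x0 W i.+1)).
Proof. by elim: W i => [|x [|y W] IH] [|i] //= h; exact: IH. Qed.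

(** Only the first two letters need care: the sliding cell passes [v] and then [u], which is the
    window of [pass2_descent]. *)
Lemma descents_slide A U c c' U' B : linear_extension (A ++ U ++ c :: B) ->
  slide adjacent U c = (c', U') -> descents U' = descents U.
Proof.
elim: U A c' U' => [|u U IH] A c' U' /=; first by move=> _ [_ <-].
move=> l; case es: (slide _ U c) => [c1 U1].
case ep: (pass _ u c1) => [c2 u1] [_ <-].
have l' : linear_extension (rcons A u ++ U ++ c :: B) by rewrite cat_rcons.
have e := IH _ _ _ l' es.
case: U l l' es e {IH} => [|v V] l l' /=; first by case=> _ <-.
case es: (slide _ V c) => [c3 V1]; case ep': (pass _ v c3) => [c4 v1] [h <-].
subst c4 => /= ->; congr cons; symmetry; apply: pass2_descent ep' ep.
have := @linear_slide (rcons (rcons A u) v) V c _ _ B _ es.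
rewrite !cat_rcons; exact.
Qed.

(** Passes are involutive, so [pass2_descent] applies backwards, to the window obtained once [u] has
    gone through [s] and [t]. *)
Lemma descents_push A S u S' u' B : linear_extension (A ++ u :: S ++ B) ->
  push adjacent u S = (S', u') -> descents S' = descents S.
Proof.
elim: S A u S' u' => [|s S IH] A u S' u' /=; first by move=> _ [<- _].
move=> l; case ep: (pass _ u s) => [s1 u1].
case es: (push _ u1 S) => [S1 u2] [<- _].
have l' : linear_extension (rcons A s1 ++ u1 :: S ++ B).
  by rewrite cat_rcons; exact: linear_pass ep.
have e := IH _ _ _ _ l' es.
case: S l l' es e {IH} => [|t S] l l' /=; first by case=> <- _.
case ep': (pass _ u1 t) => [t1 u3]; case es: (push _ u3 S) => [S3 u4] [<- _].
move=> /= ->; congr cons.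
apply: pass2_descent (pass_inv adjacentC ep') (pass_inv adjacentC ep).
by have := linear_pass l' ep'; rewrite cat_rcons; apply.
Qed.

(** Descents of [S] are tracked by pushing the cells of [U] one at a time, those of [U] by sliding
    the cells of [S]; both orders compute the same switch by [switch_cons]. *)
Lemma descents_switch A U S S' U' : linear_extension (A ++ U ++ S) ->
  switch adjacent U S = (S', U') ->
  descents S' = descents S /\ descents U' = descents U.
Proof.
move=> l ew; split.
  elim: U A S' U' l ew => [|u U IH] A S' U'; first by rewrite switch0 => _ [<- _].
  rewrite switch_cons => l; case ew: (switch _ U S) => [S1 U1].
  case ep: (push _ u S1) => [S2 u'] [<- _].
  have l' : linear_extension (rcons A u ++ U ++ S) by rewrite cat_rcons.
  rewrite -(IH _ _ _ l' ew); apply: (@descents_push A _ u _ u' U1) => //.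
  by have := linear_switch l' ew; rewrite cat_rcons.
elim: S A U S' U' l ew => [|s S IH] A U S' U' /=; first by move=> _ [_ <-].
move=> l; case es: (slide _ U s) => [s1 U1].
case ew: (switch _ U1 S) => [S1 U2] [_ <-].
rewrite -(descents_slide l es); apply: (IH (rcons A s1)) ew.
by rewrite cat_rcons; apply: linear_slide es.
Qed.

End Words.

(** * Jeu de taquin steps realised as passes *)

Section JeuDeTaquin.
Variables (n : nat) (la : seq nat).
Implicit Types (T P Q R : filling n la) (c d x y u : cell la).
Implicit Types (W A B U S V : seq (cell la)).

Definition entries T W : seq nat := [seq val (T c) | c <- W].

Lemma entries_cat T A B : entries T (A ++ B) = entries T A ++ entries T B.
Proof. exact: map_cat. Qed.

Lemma nth_entries T W L c : linear_extension W -> entries T W = L ->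
  val (T c) = nth 0 L (index c W).
Proof.
case/linear_extensionP=> _ mW _ <-.
by rewrite (nth_map c) ?nth_index ?index_mem.
Qed.

Lemma entries_inj T T' W : linear_extension W ->
  entries T W = entries T' W -> T = T'.
Proof.
move=> lW e; apply/ffunP => c; apply: val_inj.
by rewrite (nth_entries c lW e) (nth_entries c lW erefl).
Qed.

Lemma entries_index T W c : linear_extension W -> entries T W = iota 0 n ->
  val (T c) = index c W.
Proof.
move=> lW e; rewrite (nth_entries c lW e) nth_iota //.
have := congr1 size e; rewrite size_map size_iota => <-.
by rewrite index_mem; case/linear_extensionP: lW.
Qed.

Lemma standard_precedes T d c : standard T -> precedes d c -> T d < T c.
Proof.
case/and3P=> _ /forallP rT /forallP cT /precedesP[] [h1 h2].
  by move/forallP/(_ c)/implyP: (cT d); apply; rewrite h1 h2 eqxx ltnSn.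
by move/forallP/(_ c)/implyP: (rT d); apply; rewrite h1 h2 eqxx ltnSn.
Qed.

Lemma standard_injective T : standard T -> injective T.
Proof. by case/and3P=> /andP[/injectiveP]. Qed.

Lemma standard_word T : standard T ->
  exists W, linear_extension W /\ entries T W = iota 0 n.
Proof.
move=> sT; have tI := standard_injective sT.
have [/andP[_ /forallP cT] _ _] := and3P sT.
(* The default [box la] is never reached, [T] being onto. *)
pose inv i := odflt (box la) [pick c | T c == i].
have invK i : T (inv i) = i.
  rewrite /inv; case: pickP => [c /eqP //|h].
  by have /codomP[c ic] := cT i; have := h c; rewrite ic eqxx.
pose W := map inv (enum 'I_n).
have eW : map T W = enum 'I_n.
  by rewrite -map_comp -[RHS]map_id; apply: eq_map => i /=.
exists W; split; last by rewrite -val_enum_ord -eW -map_comp.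
have uW : uniq W by apply: (@map_uniq _ _ T); rewrite eW enum_uniq.
have mW c : c \in W.
  by rewrite -(mem_map tI) eW mem_enum.
have iW c : index c W = T c.
  by rewrite -(index_map tI) eW index_enum_ord.
apply/linear_extensionP; split=> // d c pdc.
by rewrite !iW; exact: standard_precedes.
Qed.

Lemma standard_fixed T : standard T -> jdt_step T = T.
Proof.
move=> sT; rewrite /jdt_step; case: pickP => // -[c d] /=.
case/and4P=> /existsP[x /andP[pxc xc]] _ _ _.
by have := standard_precedes sT pxc; lia.
Qed.

(** Standard fillings are fixed by a step, so every standard iterate agrees with the first one,
    which [jdt] selects; the number of steps can be forgotten. *)
Lemma jdt_iter R m : standard (iter m (@jdt_step n la) R) ->
  jdt R = iter m (@jdt_step n la) R.
Proof.
set f := @jdt_step n la => sQ.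
have fixI q k : standard q -> iter k f q = q.
  by move=> sq; elim: k => //= k ->; exact: standard_fixed.
have hs : has (@standard n la) (orbit f R).
  apply/hasP; exists (iter m f R) => //.
  by rewrite -fconnect_orbit fconnect_iter.
have lt : find (@standard n la) (orbit f R) < order f R.
  by rewrite -(size_orbit f R) -has_find.
have := nth_find R hs; rewrite /jdt /= -/f.
rewrite {1 3}/orbit nth_traject //; move: (find _ _) => k sk.
case: (leqP k m) => km.
  by rewrite -[in RHS](subnK km) iterD (fixI _ _ sk).
by rewrite -[in LHS](subnK (ltnW km)) iterD (fixI _ _ sQ).
Qed.

Lemma jdt_step_injective T : injective T -> injective (jdt_step T).
Proof.
move=> tI; rewrite /jdt_step; case: pickP => // -[c d] _ x y.
have swapE e : [ffun e => if e == c then T d else if e == d then T c else T e] e =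
    T (tperm c d e).
  by rewrite ffunE permE /=; case: (e == c); case: (e == d).
by rewrite !swapE => /tI/perm_inj.
Qed.

Lemma iter_jdt_step_injective m T : injective T ->
  injective (iter m (@jdt_step n la) T).
Proof. by move=> tI; elim: m => //= m; exact: jdt_step_injective. Qed.

(** Injectivity leaves [pick] no choice: the hypothesis on smaller entries makes [c] the minimal
    misplaced cell, and the last one singles out [u]. *)
Lemma jdt_step_switch T c u : injective T -> precedes u c -> T c < T u ->
  (forall x y, T x < T c -> precedes y x -> T y < T x) ->
  (forall y, precedes y c -> T y <= T u) ->
  jdt_step T = [ffun e => if e == c then T u else if e == u then T c else T e].
Proof.
move=> tI puc cu small maxu.
have mc : misplaced T c by apply/existsP; exists u; rewrite puc.
have notm x : misplaced T x -> T c <= T x.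
  case/existsP=> y /andP[pyx xy]; rewrite leqNgt; apply/negP => xc.
  by have := small _ _ xc pyx; lia.
rewrite /jdt_step; case: pickP => [[c' d'] /=|/(_ (c, u)) /= /negP[]]; last first.
  apply/and4P; split=> //; first by apply/forallP => x; apply/implyP; exact: notm.
  by apply/forallP => y; apply/implyP; exact: maxu.
case/and4P=> mc' /forallP/(_ c)/implyP/(_ mc) c'c pd' /forallP/(_ u)/implyP max'.
have e : c' = c.
  by apply: tI; apply: val_inj; apply/eqP; rewrite /= eqn_leq c'c notm.
subst c'; have e : d' = u.
  by apply: tI; apply: val_inj; apply/eqP; rewrite /= eqn_leq maxu // max'.
by subst d'.
Qed.

(** [A] holds the small entries already settled, [V] and [u] the large ones not yet passed, [c] the
    current small entry. A non-adjacent pair only changes the reading word; an adjacent pair costs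
    one step. *)
Lemma pass_jdt A V u c c' u' B T :
  linear_extension (A ++ V ++ u :: c :: B) -> injective T ->
  pass (@adjacent la) u c = (c', u') ->
  entries T A = iota 0 (T c) ->
  sorted ltn (entries T (rcons V u)) -> all (ltn (T c)) (entries T (rcons V u)) ->
  exists m, let T' := iter m (@jdt_step n la) T in
  [/\ entries T' A = entries T A, entries T' V = entries T V, T' c' = T c,
      T' u' = T u & entries T' B = entries T B].
Proof.
move=> l tI; rewrite /pass; case: ifP => [adj|_] [<- <-] eA sV aV; last by exists 0.
have l' : linear_extension ((A ++ V) ++ u :: c :: B) by rewrite -catA.
have [uW mW lW] := linear_extensionP _ l'.
have puc : precedes u c by apply: linear_precedes l' _ adj; rewrite inE eqxx.
have inA x : T x < T c -> x \in A.
  have -> : (T x < T c) = (val (T x) \in entries T A).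
    by rewrite eA mem_iota add0n.
  by case/mapP=> y yA /val_inj/tI ->.
have sA : sorted ltn (entries T A) by rewrite eA iota_ltn_sorted.
have prefix x y D E : A ++ V ++ u :: c :: B = D ++ E -> x \in D -> precedes y x ->
    y \in D /\ index y D < index x D.
  move=> eD xD /lW; rewrite -catA eD !index_cat xD.
  case: ifP => // yD; have := index_mem x D; rewrite xD; lia.
have mono D : sorted ltn (entries T D) -> forall x y, x \in D -> y \in D ->
    index y D < index x D -> T y < T x.
  move=> sD x y xD yD yx.
  have := sorted_ltn_nth ltn_trans 0 sD; move=> /(_ (index y D) (index x D)).
  rewrite !inE !size_map !index_mem xD yD => /(_ isT isT yx).
  by rewrite !(nth_map x) ?index_mem // !nth_index.
have cu : T c < T u.
  by move: aV; rewrite /entries map_rcons all_rcons => /andP[].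
exists 1 => /=; rewrite (jdt_step_switch tI puc cu); last 2 first.
(* Entries below [T c] fill [A] in increasing order, together with their predecessors, so none is
   misplaced. *)
- move=> x y xc pyx; have xA := inA _ xc.
  by have [yA yx] := prefix _ _ _ _ erefl xA pyx; exact: mono yx.
(* Any predecessor of [c] other than [u] occurs earlier: in [A] its entry is below [T c], in [V] it
   is below [T u] because the large entries increase. *)
- move=> y /lW.
  have -> : index c ((A ++ V) ++ u :: c :: B) = (size (A ++ V)).+1.
    by move: uW; rewrite -cat_rcons => /index_cat_cons ->; rewrite size_rcons.
  rewrite ltnS => iy.
  have yin : y \in A ++ rcons V u.
    rewrite -rcons_cat -cats1 mem_cat inE orbC; have [//|yu] /= := eqVneq y u.
    move: iy; rewrite index_cat; case: ifP => //= _.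
    by rewrite [u == y]eq_sym (negPf yu) addnS ltnNge leq_addr.
  move: yin; rewrite mem_cat => /orP[yA|yV].
    have : val (T y) \in entries T A by apply: map_f.
    by rewrite eA mem_iota add0n => yc; exact: ltnW (ltn_trans yc cu).
  have [->//|yu] := eqVneq y u; apply: ltnW.
  have uV : u \in rcons V u by rewrite mem_rcons inE eqxx.
  apply: (mono _ sV) => //.
  have [_ /= + _] := linear_extensionP _ l; rewrite -cat_rcons => _.
  have uu : uniq (rcons V u).
    by move: uW; rewrite -catA -(cat_rcons u V) !cat_uniq => /and3P[_ _ /andP[]].
  have -> : index u (rcons V u) = size V.
    by move: uu; rewrite -cats1 => /index_cat_cons.
  have : index y (rcons V u) < (size V).+1 by rewrite -(size_rcons V u) index_mem.
  rewrite ltnS leq_eqVlt => /orP[/eqP e|//].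
  have := nth_index y yV; rewrite e nth_rcons ltnn eqxx => uy.
  by rewrite uy eqxx in yu.
have ne D : {in D, forall x, x != c /\ x != u} ->
    entries [ffun e => if e == c then T u else if e == u then T c else T e] D =
    entries T D.
  move=> hD; apply/eq_in_map => x /hD[/negPf xc /negPf xu].
  by rewrite ffunE xc xu.
move: uW; rewrite -catA !cat_uniq /= !has_cat /= !inE !negb_or.
case/and5P=> uA /and4P[_ uA1 cA _] _ /and3P[uV cV _] /and3P[/andP[uc uB] cB _].
have uc' : u != c by [].
split; rewrite ?ffunE ?eqxx ?(negPf uc') //.
- apply: ne => x xA; split; apply/eqP => e; subst x.
    by rewrite xA in cA.
  by rewrite xA in uA1.
- apply: ne => x xA; split; apply/eqP => e; subst x.
    by rewrite xA in cV.
  by rewrite xA in uV.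
- apply: ne => x xA; split; apply/eqP => e; subst x.
    by rewrite xA in cB.
  by rewrite xA in uB.
Qed.

(** [U] is passed from its right end, so in the induction [u] waits in [V] while [c] goes through
    the rest. *)
Lemma slide_jdt A V U c c' U' B T :
  linear_extension (A ++ V ++ U ++ c :: B) -> injective T ->
  slide (@adjacent la) U c = (c', U') ->
  entries T A = iota 0 (T c) ->
  sorted ltn (entries T (V ++ U)) -> all (ltn (T c)) (entries T (V ++ U)) ->
  exists m, let T' := iter m (@jdt_step n la) T in
  [/\ entries T' A = entries T A, entries T' V = entries T V, T' c' = T c,
      entries T' U' = entries T U & entries T' B = entries T B].
Proof.
elim: U V c' U' => [|u U IH] V c' U' /=.
  by move=> _ _ [<- <-] *; exists 0.
move=> l tI; case es: (slide _ U c) => [c1 U1].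
case ep: (pass _ u c1) => [c2 u1] [<- <-] eA sV aV.
have l' : linear_extension (A ++ rcons V u ++ U ++ c :: B) by rewrite cat_rcons.
have [||m /= [mA mV mc mU mB]] := IH _ _ _ l' tI es eA; rewrite ?cat_rcons //.
have l2 : linear_extension (A ++ V ++ u :: c1 :: U1 ++ B).
  rewrite -(cat_rcons u) catA; apply: linear_slide es => //.
  by rewrite -catA.
have tI' : injective (iter m (@jdt_step n la) T) by exact: iter_jdt_step_injective.
have [] := pass_jdt l2 tI' ep.
- by rewrite mA mc.
- by rewrite mV; move: sV; rewrite -cat_rcons entries_cat => /cat_sorted2[].
- by rewrite mV mc; move: aV; rewrite -cat_rcons entries_cat all_cat => /andP[].
move=> m' /= [hA hV hc hu hB]; exists (m' + m); rewrite iterD.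
move: hB; rewrite !entries_cat => /eqP; rewrite eqseq_cat ?size_map //.
case/andP=> /eqP hU /eqP hB.
move: mV; rewrite /entries !map_rcons => /rcons_inj[mV mu].
split; [exact: etrans hA mA | exact: etrans hV mV | exact: etrans hc mc | |
        exact: etrans hB mB].
by rewrite /entries /=; congr cons; [rewrite hu mu | exact: etrans hU mU].
Qed.

(** A step picks the minimal misplaced entry, so small entries travel in increasing order, each
    completely before the next; [A] grows by the cell where the latest one stops. *)
Lemma switch_jdt A U S S' U' T :
  linear_extension (A ++ U ++ S) -> injective T ->
  switch (@adjacent la) U S = (S', U') ->
  entries T A = iota 0 (size A) -> entries T S = iota (size A) (size S) ->
  sorted ltn (entries T U) -> all (leq (size A + size S)) (entries T U) ->
  exists m, let T' := iter m (@jdt_step n la) T in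
  [/\ entries T' A = entries T A, entries T' S' = entries T S &
      entries T' U' = entries T U].
Proof.
elim: S A U S' U' T => [|s S IH] A U S' U' T /=.
  by move=> _ _ [<- <-] *; exists 0.
move=> l tI; case es: (slide _ U s) => [s1 U1].
case ew: (switch _ U1 S) => [S1 U2] [<- <-] eA [sA eS] sU aU.
have [|||m /= [mA _ ms mU mS]] := @slide_jdt A [::] U s s1 U1 S T l tI es.
- by rewrite sA.
- by [].
- by rewrite sA; apply: sub_all aU => x /=; lia.
have l2 : linear_extension (rcons A s1 ++ U1 ++ S).
  by rewrite cat_rcons; exact: linear_slide es.
have tI' : injective (iter m (@jdt_step n la) T) by exact: iter_jdt_step_injective.
have [||||m' /= [hA hS hU]] := IH _ _ _ _ _ l2 tI' ew.
- by rewrite /entries map_rcons -/(entries _ _) mA ms eA size_rcons -addn1 iotaD /= cats1 sA add0n.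
- by rewrite mS eS size_rcons.
- by rewrite mU.
- by rewrite mU size_rcons addSnnS.
exists (m' + m); rewrite iterD /=.
move: hA; rewrite /entries !map_rcons => /rcons_inj[hA hs].
split; [exact: etrans hA mA | | exact: etrans hU mU].
by rewrite /entries /=; congr cons; [rewrite hs ms | exact: etrans hS mS].
Qed.

Hypothesis la_sorted : sorted geq la.

Lemma standard_entries T W : linear_extension W -> entries T W = iota 0 n ->
  standard T.
Proof.
move=> lW e; have [uW mW _] := linear_extensionP _ lW.
have tE c := entries_index c lW e.
have sW : size W = n by have := congr1 size e; rewrite size_map size_iota.
apply/and3P; split; last 2 first.
- apply/forallP => c; apply/forallP => d; apply/implyP => /andP[/eqP h1 h2].
  by rewrite !tE; exact: linear_row.
- apply/forallP => c; apply/forallP => d; apply/implyP => /andP[/eqP h1 h2].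
  by rewrite !tE; exact: linear_col.
apply/andP; split.
  apply/injectiveP => c d /(congr1 val); rewrite !tE => h.
  by rewrite -(nth_index c (mW c)) h nth_index.
apply/forallP => i; apply/codomP.
have iW : i < size W by rewrite sW.
exists (nth (box la) W i); apply: val_inj.
by rewrite tE index_uniq.
Qed.

End JeuDeTaquin.

(** * Rotated fillings and the bijectivity of [jdt] *)

Section Rotations.
Variables (n : nat) (la : seq nat).
Hypothesis n_gt0 : 0 < n.
Implicit Types (T P Q R : filling n la) (c d x y u : cell la).
Implicit Types (W A B U S V : seq (cell la)).

Lemma val_iter_ordS k (i : 'I_n) : val (iter k (@ordS n) i) = (i + k) %% n.
Proof.
elim: k => [|k IH]; first by rewrite addn0 modn_small.
by rewrite iterS /= [nat_of_ord _]IH -addn1 modnDml addn1 addnS.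
Qed.

Lemma iota_shift m l : iota m l = [seq m + i | i <- iota 0 l].
Proof. by rewrite -iotaDl addn0. Qed.

Lemma add_fillingD j k T : add_filling j (add_filling k T) = add_filling (j + k) T.
Proof. by apply/ffunP => c; rewrite !ffunE iterD. Qed.

Lemma add_filling_n T : add_filling n T = T.
Proof.
apply/ffunP => c; rewrite ffunE; apply: val_inj.
by rewrite val_iter_ordS modnDr modn_small.
Qed.

Lemma add_filling0 T : add_filling 0 T = T.
Proof. by apply/ffunP => c; rewrite ffunE. Qed.

Lemma rotations_add R k : R \in rotations n la -> add_filling k R \in rotations n la.
Proof.
move=> rR; elim: k => [|k IH]; first by rewrite add_filling0.
rewrite -add1n -add_fillingD; move: (add_filling k R) IH => {rR}R.
rewrite !inE => /existsP[T /and3P[sT dT /existsP[j /eqP ->]]].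
apply/existsP; exists T; rewrite sT dT /=; apply/existsP.
rewrite add_fillingD add1n; have [jn|jn] := eqVneq j.+1 n.
  by exists (Ordinal n_gt0); rewrite jn add_filling_n add_filling0.
have jn' : j.+1 < n by have := ltn_ord j; lia.
by exists (Ordinal jn').
Qed.

Lemma entries_add k T W :
  entries (add_filling k T) W = [seq (i + k) %% n | i <- entries T W].
Proof.
by rewrite /entries -map_comp; apply: eq_map => c; rewrite /= ffunE val_iter_ordS.
Qed.

Lemma entries_injective T W : linear_extension W -> uniq (entries T W) -> injective T.
Proof.
case/linear_extensionP=> _ mW _ uT c d cd.
have sc : index c W < size (entries T W) by rewrite size_map index_mem.
have sd : index d W < size (entries T W) by rewrite size_map index_mem.
have := nth_uniq 0 sc sd uT.
rewrite !(nth_map (box la)) ?index_mem // !nth_index // cd eqxx => /esym/eqP e.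
by rewrite -(nth_index c (mW c)) e nth_index.
Qed.

Lemma nth_entries_iota T W a i : entries T W = iota a (size W) -> i < size W ->
  val (T (nth (box la) W i)) = a + i.
Proof. by move=> e iW; rewrite -(nth_iota 0 a iW) -e (nth_map (box la)). Qed.

(* [R = k + T] with [k = size S], the entries [1, ..., n] of [T] being read off
   along [U ++ S]. The entry [n] of [T] lies in the box, hence the box comes
   last. *)
Definition rotated_word R U S : Prop :=
  [/\ linear_extension (U ++ S), entries R U = iota (size S) (size U),
      entries R S = iota 0 (size S), size U + size S = n &
      exists S0, S = rcons S0 (box la)].

Lemma rotation_word R : R \in rotations n la -> exists U S, rotated_word R U S.
Proof.
rewrite inE => /existsP[T /and3P[]]; rewrite inE => sT /eqP dT /existsP[k /eqP eR].
have [W [lW eW]] := standard_word sT.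
have sW : size W = n by have := congr1 size eW; rewrite size_map size_iota.
have iW := entries_index (box la) lW eW.
(* A shift by 0 is traded for a shift by [n], so that the small part [S] is never empty. *)
have {k eR}[k k1 [kn eR]] : exists2 k, 0 < k & k <= n /\ R = add_filling k T.
  have [k0|k0] := posnP k.
    by exists n; rewrite // add_filling_n eR k0 add_filling0.
  by exists k => //; split=> //; apply: ltnW.
case/lastP: W lW eW sW iW => [|W0 x] lW eW sW iW; first by have := n_gt0; rewrite -sW.
have xb : x = box la.
  have [_ mW _] := linear_extensionP _ lW.
  have := nth_index x (mW (box la)); rewrite -iW.
  rewrite /delta in dT; rewrite /= dT -sW size_rcons /= nth_rcons ltnn eqxx.
  by [].
rewrite size_rcons in sW.
(* The first [n - k] entries do not wrap around when [k] is added; the others become the small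
   entries. *)
pose U := take (n - k) (rcons W0 x); pose S := drop (n - k) (rcons W0 x).
have szU : size U = n - k by rewrite size_takel // size_rcons sW leq_subr.
have szS : size S = k by rewrite size_drop size_rcons sW; lia.
have eT : entries T U = iota 0 (n - k) /\ entries T S = iota (n - k) k.
  have := eW; rewrite -(cat_take_drop (n - k) (rcons W0 x)) entries_cat.
  rewrite -[X in iota 0 X](subnK kn) iotaD add0n => /eqP.
  rewrite eqseq_cat; first by case/andP=> /eqP -> /eqP ->.
  by rewrite size_map size_iota.
exists U, S; split.
- by rewrite cat_take_drop.
- rewrite eR entries_add eT.1 szU szS [RHS]iota_shift.
  apply/eq_in_map => i; rewrite mem_iota => hi.
  by rewrite addnC modn_small //; lia.
- rewrite eR entries_add eT.2 szS [iota (n - k) k]iota_shift -map_comp.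
  rewrite -[RHS]map_id; apply/eq_in_map => i; rewrite mem_iota => hi /=.
  have -> : n - k + i + k = i + n by lia.
  by rewrite modnDr modn_small //; lia.
- by rewrite szU szS subnK.
- by exists (drop (n - k) W0); rewrite -xb /S drop_rcons //; lia.
Qed.

Hypothesis la_sorted : sorted geq la.

Lemma word_rotation R U S : rotated_word R U S -> R \in rotations n la.
Proof.
case=> l eU eS sz [S0 eS0]; set k := size S in eU eS sz.
have k_gt0 : 0 < k by rewrite /k eS0 size_rcons.
pose T := add_filling (n - k) R.
have eT : entries T (U ++ S) = iota 0 n.
  rewrite entries_add entries_cat eU eS map_cat.
  have -> : iota 0 n = iota 0 (size U) ++ iota (size U) k.
    by rewrite -sz iotaD.
  congr cat.
    rewrite [iota k _]iota_shift -map_comp -[RHS]map_id.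
    apply/eq_in_map => i; rewrite mem_iota => hi /=.
    have -> : k + i + (n - k) = i + n by lia.
    by rewrite modnDr modn_small //; lia.
  rewrite [RHS]iota_shift.
  apply/eq_in_map => i; rewrite mem_iota => hi.
  by rewrite modn_small; lia.
rewrite inE; apply/existsP; exists T; apply/and3P; split.
- by rewrite inE; exact: standard_entries eT.
- rewrite /delta; have [uW _ _] := linear_extensionP _ l.
  have /= -> := entries_index (box la) l eT.
  move: uW; rewrite eS0 -cats1 catA => uW.
  by rewrite (index_cat_cons uW) size_cat; move: sz; rewrite /k eS0 size_rcons; lia.
- apply/existsP.
  have eR : R = add_filling k T.
    by rewrite add_fillingD subnKC ?add_filling_n //; lia.
  (* A shift by [n] is not an ordinal below [n]; it is represented by 0. *)
  have [kn|kn] := eqVneq k n.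
    by exists (Ordinal n_gt0); rewrite add_filling0 {1}eR kn add_filling_n.
  have kn' : k < n by lia.
  by exists (Ordinal kn'); apply/eqP.
Qed.

Lemma word_injective R U S : rotated_word R U S -> injective R.
Proof.
case=> l eU eS _ _; apply: entries_injective l _.
rewrite entries_cat eU eS cat_uniq !iota_uniq andbT /=.
by apply/hasPn => i; rewrite !mem_iota; lia.
Qed.

Lemma jdt_word R U S S' U' : rotated_word R U S ->
  switch (@adjacent la) U S = (S', U') ->
  [/\ linear_extension (S' ++ U'), entries (jdt R) S' = iota 0 (size S'),
      entries (jdt R) U' = iota (size S') (size U') & standard (jdt R)].
Proof.
move=> w ew; have [l eU eS sz _] := w.
have [szS szU] := size_switch (@adjacent la) U S.
rewrite ew /= in szS szU.
have l' : linear_extension (S' ++ U') by exact: (@linear_switch la [::] U S) ew.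
have [|||||m /= [_ hS hU]] := @switch_jdt n la [::] U S S' U' R l _ ew.
- exact: word_injective w.
- by [].
- by [].
- by rewrite eU iota_ltn_sorted.
- by apply/allP => i; rewrite eU mem_iota => /andP[].
have sQ : standard (iter m (@jdt_step n la) R).
  apply: (standard_entries la_sorted l').
  by rewrite entries_cat hS hU eS eU -sz addnC iotaD.
by rewrite (jdt_iter sQ) hS hU eS eU szS szU.
Qed.

Lemma jdt_SYT R : R \in rotations n la -> jdt R \in SYT n la.
Proof.
move=> /rotation_word[U [S w]]; case ew: (switch (@adjacent la) U S) => [S' U'].
by rewrite inE; have [] := jdt_word w ew.
Qed.

Lemma linear_box_unique A B : linear_extension (rcons A (box la) ++ B) ->
  index (box la) (rcons A (box la) ++ B) = size A.
Proof. by rewrite cat_rcons => /linear_extensionP[u _ _]; exact: index_cat_cons. Qed.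

(** The order of the entries of [jdt R] gives the word [S' ++ U'], the box marks the end of [S'],
    and switching back returns [U] and [S], which determine [R]. *)
Lemma jdt_injective : {in rotations n la &, injective (@jdt n la)}.
Proof.
move=> R1 R2 /rotation_word[U1 [S1 w1]] /rotation_word[U2 [S2 w2]] e.
case ew1: (switch (@adjacent la) U1 S1) => [S1' U1'].
case ew2: (switch (@adjacent la) U2 S2) => [S2' U2'].
have [l1 f1 g1 s1] := jdt_word w1 ew1; have [l2 f2 g2 _] := jdt_word w2 ew2.
have [l eU1 eS1 sz1 [A1 eA1]] := w1; have [_ eU2 eS2 sz2 [A2 eA2]] := w2.
have [zS1 zU1] := size_switch (@adjacent la) U1 S1; rewrite ew1 /= in zS1 zU1.
have [zS2 zU2] := size_switch (@adjacent la) U2 S2; rewrite ew2 /= in zS2 zU2.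
have eqW : S1' ++ U1' = S2' ++ U2'.
  apply: (inj_map (inj_comp val_inj (standard_injective s1))).
  rewrite -/(entries _ _) -/(entries _ _) !entries_cat f1 g1 e f2 g2 -!iotaD.
  by rewrite zS1 zS2 zU1 zU2 addnC sz1 addnC sz2.
have bx := @adjacent_box la; have ac := @adjacentC la.
have [B1 eB1] : exists B, S1' = rcons B (box la).
  by move: ew1; rewrite eA1; exact: (switch_rcons_isolated ac bx).
have [B2 eB2] : exists B, S2' = rcons B (box la).
  by move: ew2; rewrite eA2; exact: (switch_rcons_isolated ac bx).
have szB : size S1' = size S2'.
  rewrite eB1 eB2 !size_rcons; congr _.+1.
  rewrite eB1 in l1; rewrite eB2 in l2.
  rewrite -(linear_box_unique l1) -(linear_box_unique l2).
  by rewrite -eB1 -eB2 eqW.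
move/eqP: eqW; rewrite eqseq_cat // => /andP[/eqP eS /eqP eU].
have := switch_inv ac ew1; rewrite eS eU (switch_inv ac ew2) => -[hU hS].
apply: (entries_inj l); rewrite !entries_cat eU1 eS1.
by rewrite -hU -hS eU2 eS2.
Qed.

(** A preimage comes from cutting the word of [P] after the box and switching the two parts back. *)
Lemma jdt_onto P : P \in SYT n la -> exists2 R, R \in rotations n la & jdt R = P.
Proof.
rewrite inE => sP; have [W [lW eW]] := standard_word sP.
have [uW mW _] := linear_extensionP _ lW.
have sW : size W = n by have := congr1 size eW; rewrite size_map size_iota.
have [S0 [U' eW']] : exists S0 U', W = rcons S0 (box la) ++ U'.
  case/splitPr: {uW mW lW eW sW} (mW (box la)) => A B.
  by exists A, B; rewrite cat_rcons.
subst W; set S' := rcons _ _ in lW eW uW mW sW.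
case ew: (switch (@adjacent la) S' U') => [U S].
have ew' := switch_inv (@adjacentC la) ew.
have l : linear_extension (U ++ S) by exact: (@linear_switch la [::] S' U') ew.
have [zS zU] := size_switch (@adjacent la) U S; rewrite ew' /= in zS zU.
have [uUS mUS _] := linear_extensionP _ l.
have uSU : uniq (S ++ U) by rewrite uniq_catC.
have sz : size U + size S = n by rewrite -zS -zU addnC -size_cat.
(* The reduction modulo [n] only supplies an ordinal; the index is already below [n]. *)
pose R : filling n la := [ffun c => Ordinal (ltn_pmod (index c (S ++ U)) n_gt0)].
have eR : entries R S ++ entries R U = iota 0 (size S) ++ iota (size S) (size U).
  rewrite -entries_cat -iotaD; apply: (@eq_from_nth _ 0).
    by rewrite size_map size_iota size_cat.
  move=> i; rewrite size_map => iW; rewrite (nth_map (box la)) // ffunE /=.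
  rewrite index_uniq // nth_iota -?size_cat // modn_small //.
  by rewrite -sz addnC -size_cat.
move/eqP: eR; rewrite eqseq_cat ?size_map ?size_iota // => /andP[/eqP eS /eqP eU].
have w : rotated_word R U S.
  split=> //; exact: (switch_isolated_rcons (@adjacent_box la) ew).
exists R; first exact: word_rotation w.
have [_ f g _] := jdt_word w ew'.
apply: (entries_inj lW); rewrite eW entries_cat f g -iotaD.
by rewrite -size_cat sW.
Qed.

Lemma jdt_inv_rotation P : P \in SYT n la ->
  jdt_inv P \in rotations n la /\ jdt (jdt_inv P) = P.
Proof.
move=> /jdt_onto[R rR eR]; rewrite /jdt_inv.
case: pickP => [Q /andP[rQ /eqP eQ] //|/(_ R)].
by rewrite rR eR eqxx.
Qed.

Lemma jdtK R : R \in rotations n la -> jdt_inv (jdt R) = R.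
Proof.
move=> rR; have [r e] := jdt_inv_rotation (jdt_SYT rR).
exact: jdt_injective.
Qed.

Lemma in_lower_rowE T (i j : 'I_n) c d : injective T -> T c = i -> T d = j ->
  in_lower_row T i j = (row c < row d).
Proof.
move=> tI <- <-; apply/existsP/idP => [[c' /existsP[d' /and3P[]]]|h].
  by move=> /eqP/tI -> /eqP/tI ->.
by exists c; apply/existsP; exists d; rewrite !eqxx.
Qed.

(** The two entries are both small, both large, or on either side of the cut; [descents_switch]
    settles the first two cases. *)
Lemma jdt_in_lower_row R (i : 'I_n) : R \in rotations n la -> i.+1 < n ->
  in_lower_row (jdt R) i (ordS i) = in_lower_row R i (ordS i).
Proof.
move=> rR i1; have [U [S w]] := rotation_word rR.
have rI := word_injective w; have [l eU eS sz [S0 eS0]] := w.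
case ew: (switch (@adjacent la) U S) => [S' U'].
have [l' f g sP] := jdt_word w ew; have pI := standard_injective sP.
have [zS zU] := size_switch (@adjacent la) U S; rewrite ew /= in zS zU.
have [dS dU] := @descents_switch la la_sorted [::] U S S' U' l ew.
have vS : val (ordS i) = i.+1 by rewrite /= modn_small.
have cells T c d : injective T -> val (T c) = i -> val (T d) = i.+1 ->
    in_lower_row T i (ordS i) = (row c < row d).
  move=> tI hc hd; apply: in_lower_rowE => //; apply: val_inj => //.
  by rewrite vS.
case: (ltngtP i.+1 (size S)) => hi.
- rewrite (cells _ (nth (box la) S' i) (nth (box la) S' i.+1) pI); last 2 first.
  + by rewrite (nth_entries_iota f) ?zS ?zU; lia.
  + by rewrite (nth_entries_iota f) ?zS ?zU; lia.
  rewrite (cells _ (nth (box la) S i) (nth (box la) S i.+1) rI); last 2 first.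
  + by rewrite (nth_entries_iota eS) ?zS ?zU; lia.
  + by rewrite (nth_entries_iota eS) ?zS ?zU; lia.
  by rewrite -!nth_descents ?zS // dS.
- rewrite (cells _ (nth (box la) U' (i - size S)) (nth (box la) U' (i - size S).+1) pI); last 2 first.
  + by rewrite (nth_entries_iota g) ?zS ?zU; lia.
  + by rewrite (nth_entries_iota g) ?zS ?zU; lia.
  rewrite (cells _ (nth (box la) U (i - size S)) (nth (box la) U (i - size S).+1) rI); last 2 first.
  + by rewrite (nth_entries_iota eU) ?zS ?zU; lia.
  + by rewrite (nth_entries_iota eU) ?zS ?zU; lia.
  by rewrite -!nth_descents ?zU ?dU //; lia.
(* Here [i] is the last small entry, in the box before and after [jdt]; row 0 is above every other
   cell, so both sides are true. *)
- have [S0' eS0'] : exists V, S' = rcons V (box la).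
    by move: ew; rewrite eS0; apply: switch_rcons_isolated; [exact: adjacentC | exact: adjacent_box].
  have lastE V : nth (box la) (rcons V (box la)) (size V) = box la.
    by rewrite nth_rcons ltnn eqxx.
  have iS : nth (box la) S i = box la.
    by move: hi; rewrite eS0 size_rcons => -[->].
  have iS' : nth (box la) S' i = box la.
    by move: hi; rewrite -zS eS0' size_rcons => -[->].
  rewrite (cells _ (nth (box la) S' i) (nth (box la) U' 0) pI); last 2 first.
  + by rewrite (nth_entries_iota f) ?zS ?zU; lia.
  + by rewrite (nth_entries_iota g) ?zS ?zU; lia.
  rewrite (cells _ (nth (box la) S i) (nth (box la) U 0) rI); last 2 first.
  + by rewrite (nth_entries_iota eS) ?zS ?zU; lia.
  + by rewrite (nth_entries_iota eU) ?zS ?zU; lia.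
  rewrite iS iS' row_box.
  have pos c : c != box la -> 0 < row c.
    by case: (cell_box_or c) => [->|[]//]; rewrite eqxx.
  rewrite !pos //; apply/eqP => e.
  + have := nth_entries_iota eU (_ : 0 < size U); rewrite e -iS => h.
    have := nth_entries_iota eS (_ : i < size S); rewrite h; lia.
  + have := nth_entries_iota g (_ : 0 < size U'); rewrite e -iS' => h.
    have := nth_entries_iota f (_ : i < size S'); rewrite h; lia.
Qed.

Lemma cDes_rot_add R : cDes_rot (add_filling 1 R) = add_set 1 (cDes_rot R).
Proof.
have oI : injective (@ordS n) := can_inj (@ordSK n).
have lowE i j : in_lower_row (add_filling 1 R) (ordS i) (ordS j) = in_lower_row R i j.
  by apply: eq_existsb => c; apply: eq_existsb => d; rewrite !ffunE /= !(inj_eq oI).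
apply/setP => j; rewrite -(ord_predK j) (mem_imset _ _ oI) !inE lowE.
by [].
Qed.

End Rotations.

(** * Cyclic descents and the promotion action *)

Theorem proposition5p3 (n : nat) (la : seq nat)
    (hn : 2 <= n) (hla : is_part n.-1 la) :
  (forall P : filling n la, P \in SYT n la ->
     cDes P :&: below_n n = Des P)
  /\
  [/\ [set promotion P | P in SYT n la] = SYT n la,
      {in SYT n la &, injective (@promotion n la)},
      (forall P : filling n la, P \in SYT n la ->
         iter n (@promotion n la) P = P)
    & (forall P : filling n la, P \in SYT n la ->
         cDes (promotion P) = add_set 1 (cDes P))].
Proof.
have n_gt0 : 0 < n := ltnW hn.
have [la_sorted _ _] := and3P hla.
have invP := jdt_inv_rotation n_gt0 la_sorted.
(* Conjugated by [jdt], promotion is the rotation of entries by one. *)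
have promP P : P \in SYT n la ->
    promotion P \in SYT n la /\ jdt_inv (promotion P) = add_filling 1 (jdt_inv P).
  move=> /invP[r _]; have r1 := rotations_add n_gt0 1 r.
  by split; [exact: jdt_SYT | exact: jdtK].
have iterP m P : P \in SYT n la -> iter m (@promotion n la) P \in SYT n la /\
    jdt_inv (iter m (@promotion n la) P) = add_filling m (jdt_inv P).
  move=> sP; elim: m => [|m [IH e]] /=; first by rewrite add_filling0.
  by have [s ->] := promP _ IH; rewrite e add_fillingD.
have iterN P : P \in SYT n la -> iter n (@promotion n la) P = P.
  move=> sP; have [s e] := iterP n P sP.
  by rewrite -(invP _ s).2 e add_filling_n // (invP _ sP).2.
have prom_inj : {in SYT n la &, injective (@promotion n la)}.
  (* Since the [n]-th iterate is the identity, the iterate [n.-1] is a left inverse. *)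
  have iterK P : P \in SYT n la -> iter n.-1 (@promotion n la) (promotion P) = P.
    by move=> sP; rewrite -iterSr prednK // iterN.
  by move=> P Q sP sQ e; rewrite -(iterK P sP) e iterK.
split.
  move=> P sP; have [r e] := invP _ sP; apply/setP => i.
  rewrite !inE andbC; case i1: (i.+1 < n) => //=.
  by rewrite -[in RHS]e jdt_in_lower_row.
split=> // [|P sP]; last by rewrite /cDes (promP _ sP).2 cDes_rot_add.
(* An injective self-map of a finite set is onto. *)
apply/eqP; rewrite eqEcard (card_in_imset prom_inj) leqnn andbT.
by apply/subsetP => _ /imsetP[P sP ->]; exact: (promP _ sP).1.
Qed.
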